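(* Let $0<\alpha<1$. (1) Let $\Psi=\{\psi_1,\dots,\psi_M\}$ be a finite, non-singular, hyperbolic I.F.S. with attractor $K_\Psi$, and let $\Phi=\{\phi_\beta:\beta\in K_\Psi\}$, where $\phi_\beta(x)=\alpha x+(1-\alpha)\beta$ for $x\in\mathbf{R}$. Then the attractor $K_\Phi$ of $\Phi$, i.e. the unique nonempty compact set $K_\Phi\subset\mathbf{R}$ with $K_\Phi=\bigcup_{\beta\in K_\Psi}\phi_\beta(K_\Phi)$, is a finite union of closed intervals. (2) The same is true when $K_\Psi$ in the definition of $\Phi$ is replaced by a Cantor set $K\subset\mathbf{R}$ admitting a construction of uniformly lower bounded dissections: the unique nonempty compact set $K_\Phi\subset\mathbf{R}$ with $K_\Phi=\bigcup_{\beta\in K}\phi_\beta(K_\Phi)$ is a finite union of closed intervals.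
   Context: **Non-singular hyperbolic I.F.S.** A finite, non-singular, hyperbolic I.F.S. is a finite set $\Psi=\{\psi_1,\dots,\psi_M\}$ of $C^2$ maps $\psi_i:I\to I$ of a compact interval $I\subset\mathbf{R}$ into itself, for which there are constants $\sigma,\delta$ with $0<\sigma\le|\psi_i'(x)|\le\delta<1$ for all $x\in I$ and all $i$, and such that at least two of the maps have different fixed points (all fixed points lie in $I$). Its attractor $K_\Psi$ is the unique nonempty compact set $K\subseteq I$ with $K=\bigcup_{i=1}^M\psi_i(K)$. **Cantor set.** A Cantor set is a nonempty compact totally disconnected subset of $\mathbf{R}$ with no isolated points. **Constructions.** Let $W$ be the set of finite binary words (including the empty word $\emptyset$), $|w|$ the length of $w$. A construction is a map $\mathcal I: w\mapsto I_w=[a_w,b_w]$ from $W$ to closed bounded intervals with $a_w<b_w$, such that for every $w\in W$: $a_w=a_{w0}<b_{w0}<a_{w1}<b_{w1}=b_w$. It constructs the set $C(\mathcal I)=\bigcap_{n\ge0}\bigcup_{|w|=n}I_w$. Its dissection ratios are $r(\mathcal I)_{wj}=\frac{b_{wj}-a_{wj}}{b_w-a_w}$, $w\in W$, $j\in\{0,1\}$. The construction is of uniformly lower bounded dissections (ulbd) if there is a constant $a>0$ such that all dissection ratios are $\ge a$. A Cantor set $K$ admits such a construction if $K=C(\mathcal I)$ for some ulbd construction $\mathcal I$. *)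

(* Defs.v *)
From HB Require Import structures.
From mathcomp Require Import all_boot all_order all_algebra.
From mathcomp Require Import all_classical all_reals all_analysis.

Set Implicit Arguments.
Unset Strict Implicit.
Unset Printing Implicit Defensive.

Import Order.TTheory GRing.Theory Num.Theory.
Import numFieldNormedType.Exports.

Local Open Scope classical_set_scope.
Local Open Scope ring_scope.

(* Calculus relative to a subset I of R: difference quotients are only taken
   along points of I, hence derivatives are one-sided at the endpoints of a
   compact interval. *)

Definition diff_quot (R : realType) (f : R -> R) (x y : R) : R :=
  (f y - f x) / (y - x).

Definition derivable_in (R : realType) (I : set R) (f : R -> R) : Prop :=
  forall x, I x -> cvg (diff_quot f x y @[y --> within I x^']).

(* As with the library's lim, meaningful only where the limit exists. *)
Definition derive_in (R : realType) (I : set R) (f : R -> R) (x : R) : R :=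
  lim (diff_quot f x y @[y --> within I x^']).

Definition C2_in (R : realType) (I : set R) (f : R -> R) : Prop :=
  [/\ derivable_in I f,
      derivable_in I (derive_in I f) &
      {within I, continuous (derive_in I (derive_in I f))}].

(* The maps are total functions on R, but only their values on `[p, q] matter.
   The last field forces p < q, and M >= 2 by uniqueness of fixed points. *)
Record hyperbolic_ifs (R : realType) (p q : R) (M : nat)
    (psi : 'I_M -> R -> R) : Prop := HyperbolicIFS {
  ifs_maps : forall i x, x \in `[p, q] -> psi i x \in `[p, q];
  ifs_C2 : forall i, C2_in `[p, q] (psi i);
  ifs_bounds : exists sigma delta : R, [/\ 0 < sigma, delta < 1 &
    forall i x, x \in `[p, q] ->
      sigma <= `|derive_in `[p, q] (psi i) x| <= delta];
  ifs_fixed : exists (i j : 'I_M) (x y : R),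
    [/\ x \in `[p, q], y \in `[p, q], psi i x = x, psi j y = y & x <> y]
}.

Definition compact_invariant (R : realType) (T : Type) (D : set T)
    (f : T -> R -> R) (K : set R) : Prop :=
  [/\ K !=set0, compact K & K = \bigcup_(t in D) (f t @` K)].

Definition is_attractor (R : realType) (T : Type) (X : set R) (D : set T)
    (f : T -> R -> R) (K : set R) : Prop :=
  [/\ K `<=` X, compact_invariant D f K &
      forall L, L `<=` X -> compact_invariant D f L -> L = K].

Definition phi (R : realType) (alpha beta x : R) : R :=
  alpha * x + (1 - alpha) * beta.

(* Nondegenerate closed intervals. *)
Definition finite_union_itv (R : realType) (K : set R) : Prop :=
  exists (n : nat) (c d : 'I_n -> R),
    (forall i, c i < d i) /\ K = \bigcup_i `[c i, d i]%classic.

Definition cantor_set (R : realType) (K : set R) : Prop :=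
  [/\ K !=set0, compact K, totally_disconnected K & isolated K = set0].

(* Binary words are w : seq bool, and the words w0, w1 are rcons w false,
   rcons w true; I_w = [a w, b w]. *)
Definition construction (R : realType) (a b : seq bool -> R) : Prop :=
  forall w, a w < b w /\
    [/\ a w = a (rcons w false),
        a (rcons w false) < b (rcons w false),
        b (rcons w false) < a (rcons w true),
        a (rcons w true) < b (rcons w true) &
        b (rcons w true) = b w].

Definition constructed_set (R : realType) (a b : seq bool -> R) : set R :=
  \bigcap_(n in [set: nat]) \bigcup_(w in [set w | size w = n]) `[a w, b w]%classic.

Definition dissection_ratio (R : realType) (a b : seq bool -> R)
    (w : seq bool) (j : bool) : R :=
  (b (rcons w j) - a (rcons w j)) / (b w - a w).

Definition ulbd (R : realType) (a b : seq bool -> R) : Prop :=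
  exists2 c : R, 0 < c & forall w j, c <= dissection_ratio a b w j.

Definition admits_ulbd (R : realType) (K : set R) : Prop :=
  exists a b : seq bool -> R,
    [/\ construction a b, ulbd a b & K = constructed_set a b].

(* Main.v *)
(* The attractor is X = (1 - alpha) (K + alpha K + alpha^2 K + ...).  Cover K at
   every scale by "bridges": intervals meeting K, such that the two
   children at the ends of a bridge have length at least c times its own.  If
   N bridges have lengths comparable up to the factor c and (N - 1) c >= 1, then
   replacing the longest one by one of its two end children leaves no hole in
   their sum and keeps the lengths comparable; iterating, the sum of the N
   pieces of K is the whole sum of the N bridges.  Choosing bridges of K,
   alpha K, ..., alpha^(N-1) K of about the length of alpha^N K around the first
   N digits of a point of X, one sees that every point of X lies in a segment of
   X whose length is bounded below, so X is a finite union of segments.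

   For a construction the bridges are its intervals; for an I.F.S. they are the
   convex hulls of the cylinders psi_w(K), and bounded distortion supplies c. *)
Require Import Defs.
From HB Require Import structures.
From mathcomp Require Import all_boot all_order all_algebra.
From mathcomp Require Import all_classical all_reals all_analysis.
From mathcomp Require Import ring lra.
Import Order.TTheory GRing.Theory Num.Theory.
Import numFieldNormedType.Exports.
Local Open Scope classical_set_scope.
Local Open Scope ring_scope.

Set Implicit Arguments.
Unset Strict Implicit.
Unset Printing Implicit Defensive.

(** * Bridge systems, and sums of scaled bridges *)

Lemma geometric_small (R : realType) (rho C e : R) :
  0 <= rho < 1 -> 0 < e -> exists n, rho ^+ n * C <= e.
Proof.
move=> /andP[rho0 rho1] e0.
have rho1' : `|rho| < 1 by rewrite ger0_norm.
have d0 : 0 < e / (`|C| + 1) by rewrite divr_gt0// ltr_wpDl.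
have [n _ /(_ n (leqnn n))] := (cvgr0Pnorm_lt _).1 (cvg_expr rho1') _ d0.
rewrite /= ger0_norm ?exprn_ge0// ltr_pdivlMr ?ltr_wpDl// => rhoC.
exists n; apply: le_trans (ltW rhoC); apply: ler_wpM2l; first exact: exprn_ge0.
by rewrite (le_trans (ler_norm C))// lerDl.
Qed.

Lemma nested_cat (R : realType) (T : Type) (lo hi : seq T -> R) :
  (forall w j, lo w <= lo (rcons w j) /\ hi (rcons w j) <= hi w) ->
  forall w v, lo w <= lo (w ++ v) /\ hi (w ++ v) <= hi w.
Proof.
move=> nest w v.
elim/last_ind: v => [|v j [IHl IHh]]; first by rewrite cats0.
rewrite -rcons_cat; have [hl hh] := nest (w ++ v) j.
by split; [exact: le_trans hl|exact: le_trans hh _].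
Qed.

(* The "bridges" [lo w, hi w] are only required to overlap suitably: a bridge
   need not be the union of its children and of the gaps between them, and
   distinct bridges of the same depth may intersect. *)
Record bridge_system (R : realType) (T : Type) (K : set R) (c : R)
    (lo hi : seq T -> R) : Prop := BridgeSystem {
  bridge_ratio : 0 < c;
  bridge_root : lo [::] < hi [::];
  bridge_nested : forall w j,
    lo w <= lo (rcons w j) /\ hi (rcons w j) <= hi w;
  bridge_len : forall w j,
    c * (hi w - lo w) <= hi (rcons w j) - lo (rcons w j)
      <= (1 - c) * (hi w - lo w);
  bridge_left : forall w, exists j, lo (rcons w j) = lo w;
  bridge_right : forall w, exists j, hi (rcons w j) = hi w;
  bridge_meet : forall w, exists2 x, K x & lo w <= x <= hi w;
  bridge_cover : forall x n, K x -> exists2 w, size w = n & lo w <= x <= hi w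
}.

Section Bridges.
Variables (R : realType) (T : Type) (K : set R) (c : R) (lo hi : seq T -> R).
Hypothesis KB : bridge_system K c lo hi.

Let c0 : 0 < c. Proof. exact: bridge_ratio KB. Qed.

Lemma bridge_gt0 w : lo w < hi w.
Proof.
elim/last_ind: w => [|w j IH]; first exact: bridge_root KB.
have /andP[+ _] := bridge_len KB w j.
rewrite -subr_gt0 in IH; rewrite -[lo _ < _]subr_gt0.
by apply: lt_le_trans; exact: mulr_gt0.
Qed.

Lemma bridge_ratio_lt1 : c < 1.
Proof.
have [j _] := bridge_left KB [::].
have /andP[h1 h2] := bridge_len KB [::] j.
have := bridge_root KB; rewrite -subr_gt0 => l0.
have := le_trans h1 h2; rewrite ler_pM2r// => h.
by have := c0; lra.
Qed.

Lemma bridge_geometric w :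
  hi w - lo w <= (1 - c) ^+ size w * (hi [::] - lo [::]).
Proof.
elim/last_ind: w => [|w j IH]; first by rewrite expr0 mul1r.
have /andP[_ h] := bridge_len KB w j.
rewrite (le_trans h)// size_rcons exprS -mulrA ler_wpM2l// subr_ge0.
exact/ltW/bridge_ratio_lt1.
Qed.

(** Go down a chain of bridges containing [x] and stop at the first one of length at most [r]: its
    parent is longer than [r], so it has length at least [c * r]. *)
Lemma bridge_scale x r : K x -> 0 < r <= hi [::] - lo [::] ->
  exists2 w, lo w <= x <= hi w & c * r <= hi w - lo w <= r.
Proof.
move=> Kx /andP[r0 rl].
have cr : 0 <= 1 - c < 1.
  by have := bridge_ratio_lt1; have := c0; move=> *; apply/andP; split; lra.
have [n hn] := geometric_small (hi [::] - lo [::]) cr r0.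
have [w sw xw] := bridge_cover KB n Kx.
have len_w : hi w - lo w <= r.
  by rewrite (le_trans (bridge_geometric w))// sw.
have ex : exists k, hi (take k w) - lo (take k w) <= r.
  by exists (size w); rewrite take_size.
case: (ex_minnP ex) => k hk kmin.
exists (take k w).
  have [h1 h2] := nested_cat (bridge_nested KB) (take k w) (drop k w).
  rewrite cat_take_drop in h1 h2.
  by case/andP: xw => x1 x2; rewrite (le_trans h1 x1) (le_trans x2 h2).
rewrite hk andbT.
case: k hk kmin => [_ _|k hk kmin].
  rewrite take0 (le_trans _ rl)// ler_piMl ?(ltW r0)//.
  exact/ltW/bridge_ratio_lt1.
have kr : r < hi (take k w) - lo (take k w).
  by rewrite ltNge; apply/negP => /kmin; rewrite ltnn.
have kw : (k < size w)%N.
  rewrite ltnNge; apply/negP => wk; move: kr.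
  by rewrite take_oversize// ltNge len_w.
(* Only a letter is wanted here, as the default value of [nth]. *)
have [j _] := bridge_left KB [::].
rewrite (take_nth j kw); have /andP[+ _] := bridge_len KB (take k w) (nth j w k).
by apply: le_trans; rewrite ler_pM2l// ltW.
Qed.

Section Sums.
Variables (N : nat) (lam : 'I_N -> R).
Hypotheses (lam0 : forall n, 0 < lam n) (cN : 1 <= N%:R * c - c).

Let slo (w : 'I_N -> seq T) := \sum_n lam n * lo (w n).
Let shi (w : 'I_N -> seq T) := \sum_n lam n * hi (w n).
Let len (w : 'I_N -> seq T) n := lam n * (hi (w n) - lo (w n)).
Let balanced w := forall i j, c * len w i <= len w j.

Let shi_slo w : shi w - slo w = \sum_n len w n.
Proof. by rewrite -sumrB; apply: eq_bigr => n _; rewrite /len mulrBr. Qed.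

(* Splitting the longest of the scaled bridges leaves no hole in their sum,
   since the other ones are together at least as long, and it keeps all of
   them comparable. *)
Let split_step w t : balanced w -> slo w <= t <= shi w ->
  exists w', [/\ balanced w', slo w' <= t <= shi w' &
    shi w' - slo w' <= (1 - c / N%:R) * (shi w - slo w)].
Proof.
move=> bw /andP[tl th].
have N0 : (0 < N)%N.
  by rewrite lt0n; apply/eqP => N0; have := c0; have := cN; rewrite N0; lra.
have [i imax] : exists i, forall j, len w j <= len w i.
  have i0 : 'I_N := Ordinal N0.
  case: (@arg_maxP _ _ _ i0 xpredT (len w) erefl) => i _ h.
  by exists i => j; exact: h.
pose upd j n := if n == i then rcons (w n) j else w n.
have len0 v n : 0 < len v n by rewrite mulr_gt0// subr_gt0 bridge_gt0.
have len_upd j : c * len w i <= len (upd j) i <= (1 - c) * len w i.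
  rewrite /len /upd eqxx; have /andP[h1 h2] := bridge_len KB (w i) j.
  rewrite mulrCA ler_pM2l// h1/= mulrCA ler_pM2l//.
have len_other j n : n != i -> len (upd j) n = len w n.
  by rewrite /len /upd => /negbTE ->.
have bupd j : balanced (upd j).
  move=> m n; have /andP[h1 h2] := len_upd j.
  have hm : len (upd j) m <= len w i.
    have [->|mi] := eqVneq m i; last by rewrite len_other.
    rewrite (le_trans h2)// ler_piMl ?(ltW (len0 _ _))//; have := c0; lra.
  have hn : c * len w i <= len (upd j) n.
    have [->//|ni] := eqVneq n i.
    by rewrite len_other// (le_trans _ (bw i n)).
  by apply: le_trans hn; rewrite ler_pM2l.
have sumE (F : 'I_N -> R) : \sum_n F n = F i + \sum_(n | n != i) F n.
  by rewrite (bigD1 i).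
(* The longest bridge carries at least a fraction [1 / N] of the total length, and a child loses at
   least a fraction [c] of its parent. *)
have shrink j :
    shi (upd j) - slo (upd j) <= (1 - c / N%:R) * (shi w - slo w).
  rewrite !shi_slo !sumE (eq_bigr (len w)); last exact: len_other.
  have /andP[_ h] := len_upd j.
  have hS : \sum_n len w n <= N%:R * len w i.
    rewrite (le_trans (ler_sum _ (fun n _ => imax n)))//.
    by rewrite sumr_const card_ord mulr_natl.
  have NR : 0 < N%:R :> R by rewrite ltr0n.
  have : c / N%:R * \sum_n len w n <= c * len w i.
    by rewrite mulrAC ler_pdivrMr// -mulrA ler_pM2l// [_ * N%:R]mulrC.
  rewrite sumE; lra.
set S0 := \sum_(n | n != i) lam n * lo (w n).
set S1 := \sum_(n | n != i) lam n * hi (w n).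
have sloE j : slo (upd j) = lam i * lo (rcons (w i) j) + S0.
  rewrite /slo sumE {1}/upd eqxx; congr (_ + _).
  by apply: eq_bigr => n /negbTE ni; rewrite /upd ni.
have shiE j : shi (upd j) = lam i * hi (rcons (w i) j) + S1.
  rewrite /shi sumE {1}/upd eqxx; congr (_ + _).
  by apply: eq_bigr => n /negbTE ni; rewrite /upd ni.
have others : len w i <= S1 - S0.
  rewrite -sumrB; apply: (@le_trans _ _ (\sum_(n | n != i) c * len w i)).
    rewrite sumr_const cardC1 card_ord -mulr_natl -subn1 natrB//.
    have := len0 w i; have := cN; nra.
  by apply: ler_sum => n _; rewrite -mulrBr bw.
rewrite /slo sumE -/S0 in tl; rewrite /shi sumE -/S1 in th.
have [j0 hj0] := bridge_left KB (w i).
have [j1 hj1] := bridge_right KB (w i).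
move: others; rewrite /len mulrBr => others.
(* Use the left child unless [t] lies above its sum. In that case the right child works, because its
   sum starts at most at [lam i * hi (w i) + S0], which is at most [lam i * lo (w i) + S1] by
   [others], hence below [t]. *)
case: (lerP t (lam i * hi (rcons (w i) j0) + S1)) => ht.
  by exists (upd j0); split; [exact: bupd| |exact: shrink]; rewrite sloE shiE hj0 tl.
exists (upd j1); split; [exact: bupd| |exact: shrink]; rewrite sloE shiE hj1 th andbT.
have : lam i * lo (w i) <= lam i * hi (rcons (w i) j0).
  by rewrite ler_pM2l// -hj0 ltW// bridge_gt0.
have : lam i * lo (rcons (w i) j1) <= lam i * hi (w i).
  by rewrite ler_pM2l// -hj1 ltW// bridge_gt0.
lra.
Qed.

(** Splitting repeatedly shrinks the sum interval around [t] geometrically; any points of [K] chosen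
    in the final bridges then have a weighted sum close to [t]. *)
Lemma bridge_sum_approx w t e : balanced w -> slo w <= t <= shi w -> 0 < e ->
  exists2 k : 'I_N -> R, (forall n, K (k n)) &
    `|t - \sum_n lam n * k n| <= e.
Proof.
move=> bw tw e0.
have rho01 : 0 <= 1 - c / N%:R < 1.
  have NR : 0 < N%:R :> R.
    rewrite ltr0n lt0n; apply/eqP => N0.
    by have := c0; have := cN; rewrite N0; lra.
  rewrite subr_ge0 ler_pdivrMr// mul1r ltrBlDr ltrDl divr_gt0//.
  rewrite andbT; have := bridge_ratio_lt1; have := c0; have := cN.
  have : 1 <= N%:R :> R by rewrite ler1n -(ltr0n R).
  lra.
have [n hn] := geometric_small (shi w - slo w) rho01 e0.
have [v [bv tv hv]] : exists v, [/\ balanced v, slo v <= t <= shi v &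
    shi v - slo v <= (1 - c / N%:R) ^+ n * (shi w - slo w)].
  elim: {hn} n => [|n [v [bv tv hv]]]; first by exists w; rewrite expr0 mul1r.
  have [v' [bv' tv' hv']] := split_step bv tv.
  exists v'; split => //; rewrite (le_trans hv')// exprS -mulrA ler_wpM2l//.
  by case/andP: rho01.
have meet n' : exists x, K x /\ lo (v n') <= x <= hi (v n').
  by have [x Kx xv] := bridge_meet KB (v n'); exists x.
have [k hk] := choice meet.
exists k => [n'|]; first by have [] := hk n'.
have kl : slo v <= \sum_n lam n * k n.
  by apply: ler_sum => n' _; rewrite ler_pM2l//; have [_ /andP[]] := hk n'.
have kh : \sum_n lam n * k n <= shi v.
  by apply: ler_sum => n' _; rewrite ler_pM2l//; have [_ /andP[]] := hk n'.
case/andP: tv => tl th.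
rewrite ler_norml; apply/andP; split; lra.
Qed.

End Sums.
End Bridges.

(** * Closed and compact subsets of the line *)

Lemma closureP_dist (R : realType) (A : set R) (x : R) :
  closure A x <-> forall e : R, 0 < e -> exists2 y, A y & `|x - y| <= e.
Proof.
split=> [Ax e e0|Ax B /nbhs_ballP[e /= e0 eB]].
  by have [y [Ay /ltW]] := Ax _ (nbhsx_ballx x e e0); exists y.
have [y Ay xy] := Ax (e / 2) (divr_gt0 e0 (ltr0Sn _ 1)).
exists y; split => //; apply: eB; rewrite -ball_normE /=.
by rewrite (le_lt_trans xy)// ltr_pdivrMr// ltr_pMr// ltr1n.
Qed.

Lemma closed_dist (R : realType) (A : set R) (x : R) : closed A ->
  (forall e : R, 0 < e -> exists2 y, A y & `|x - y| <= e) -> A x.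
Proof. by move=> /(_ x) + /closureP_dist; apply. Qed.

Lemma closure_subset_closed (T : topologicalType) (A B : set T) :
  closed B -> A `<=` B -> closure A `<=` B.
Proof. by move=> clB AB x /(closureS AB)/clB. Qed.

Lemma compact_closedR (R : realType) (A : set R) : compact A -> closed A.
Proof. by apply: compact_closed; exact: norm_hausdorff. Qed.

Lemma compact_normr_le (R : realType) (A : set R) :
  compact A -> exists C : R, forall x, A x -> `|x| <= C.
Proof.
move=> /compact_bounded[M [_ h]]; exists (M + 1) => x Ax.
by apply: (h (M + 1)) Ax; rewrite ltrDl.
Qed.

(** * The attractor of the maps [phi alpha b], for [b] in a compact set *)

Section Attractor.
Variables (R : realType) (alpha : R).
Hypotheses (alpha0 : 0 < alpha) (alpha1 : alpha < 1).
Variable K : set R.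

(** Starting from all of [K], rather than from one point, makes the orbit equal to its image under
    the system; its closure will be the attractor. *)
Inductive orbit : set R :=
| orbit_base x of K x : orbit x
| orbit_step x b of orbit x & K b : orbit (phi alpha b x).

Let hutch (X : set R) := \bigcup_(b in K) (phi alpha b @` X).

(* Every b in K is the fixed point of [phi alpha b], so K is contained in its
   image under the system. *)
Lemma orbit_invariant : orbit = hutch orbit.
Proof.
apply/seteqP; split=> [x [{}x Kx|{}x b ox Kb]|_ [b Kb [x ox <-]]].
- exists x => //; exists x; first exact: orbit_base.
  by rewrite /phi -mulrDl addrC subrK mul1r.
- by exists b => //; exists x.
- exact: orbit_step.
Qed.

Lemma orbit_bounded (C : R) : (forall x, K x -> `|x| <= C) ->
  forall x, orbit x -> `|x| <= C.
Proof.
move=> KC x; elim=> {x} [x /KC//|x b _ xC /KC bC].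
rewrite /phi (le_trans (ler_normD _ _))// !normrM.
rewrite (gtr0_norm alpha0) (@gtr0_norm _ (1 - alpha)) ?subr_gt0//.
have := ler_wpM2l (ltW alpha0) xC.
have : (1 - alpha) * `|b| <= (1 - alpha) * C by rewrite ler_wpM2l// subr_ge0 ltW.
lra.
Qed.

(** The union over [K] is the image of [X * K] under one continuous map of two variables. *)
Lemma compact_hutch X : compact X -> compact K -> compact (hutch X).
Proof.
move=> cX cK.
have -> : hutch X = (fun z => alpha * z.1 + (1 - alpha) * z.2) @` (X `*` K).
  apply/seteqP; split=> [_ [b Kb [x Xx <-]]|_ [[x b] [/= Xx Kb] <-]].
    by exists (x, b).
  by exists b => //; exists x.
apply: continuous_compact; last exact: compact_setX.
apply: continuous_subspaceT => z.
by apply: cvgD; (apply: cvgM; first exact: cvg_cst);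
  [exact: cvg_fst|exact: cvg_snd].
Qed.

(** The image of the closure is compact, hence closed, and contains the orbit; conversely each map
    is a contraction preserving the orbit, hence preserves its closure. *)
Lemma closure_orbit_invariant : K !=set0 -> compact K ->
  compact_invariant K (phi alpha) (closure orbit).
Proof.
move=> [k Kk] cK.
have [C KC] := compact_normr_le cK.
have co : compact (closure orbit).
  apply: (subclosed_compact (@closed_closure _ _) (@segment_compact _ (- C) C)).
  apply: closure_subset_closed => [|x /(orbit_bounded KC)].
    exact: interval_closed.
  by rewrite ler_norml /= in_itv.
split=> //; first by exists k; apply/subset_closure/orbit_base.
rewrite -/(hutch _); apply/seteqP; split.
  apply: closure_subset_closed.
    by apply: compact_closedR; exact: compact_hutch.
  rewrite [X in X `<=` _]orbit_invariant.
  by move=> _ [b Kb [x ox <-]]; exists b => //; exists x => //; exact: subset_closure.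
move=> _ [b Kb [x /closureP_dist ox <-]]; apply/closureP_dist => e e0.
have [y oy xy] := ox e e0.
exists (phi alpha b y); first exact: orbit_step.
rewrite /phi opprD addrACA subrr addr0 -mulrBr normrM gtr0_norm//.
by rewrite (le_trans _ xy)// ler_piMl// ltW.
Qed.

(** Write a point of [X] as an [n]-fold image of a point of [X] and replace the latter by a point of
    [L]: the error is of order [alpha ^+ n]. Used in both directions, this gives uniqueness of the
    attractor. *)
Lemma invariant_subset X L : compact X -> X `<=` hutch X ->
  compact L -> L !=set0 -> hutch L `<=` L -> X `<=` L.
Proof.
move=> cX XF cL [l Ll] FL x Xx.
have [C XC] := compact_normr_le cX.
apply: (closed_dist (compact_closedR cL)) => e e0.
have al : 0 <= alpha < 1 by rewrite ltW.
have [n hn] := geometric_small (C + `|l|) al e0.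
suff [y Ly xy] : exists2 y, L y & `|x - y| <= alpha ^+ n * (C + `|l|).
  by exists y => //; exact: le_trans hn.
elim: {hn} n x Xx => [|n IH] x Xx.
  by exists l => //; rewrite mul1r (le_trans (ler_normB _ _))// lerD2r XC.
have [b Kb [x' Xx' <-]] := XF _ Xx.
have [y Ly xy] := IH x' Xx'.
exists (phi alpha b y); first by apply: FL; exists b => //; exists y.
rewrite /phi opprD addrACA subrr addr0 -mulrBr normrM gtr0_norm//.
by rewrite exprS -mulrA ler_pM2l.
Qed.

Lemma closure_orbit_attractor : K !=set0 -> compact K ->
  is_attractor [set: R] K (phi alpha) (closure orbit).
Proof.
move=> K0 cK; have oI := closure_orbit_invariant K0 cK; split=> //.
move=> L _ [L0 cL LF]; case: oI => o0 co oF.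
apply/seteqP; split; apply: invariant_subset => //.
- by rewrite {1}LF.
- by rewrite {2}oF.
- by rewrite {1}oF.
- by rewrite {2}LF.
Qed.

Section Expansion.
Variable X : set R.
Hypothesis XF : X = hutch X.

(** This unfolds the invariance [n] times; the outermost map contributes the digit [b ord0], and all
    later terms are scaled by [alpha]. *)
Lemma expansion_mem n (b : 'I_n -> R) y : (forall i, K (b i)) -> X y ->
  X (\sum_(i < n) (1 - alpha) * alpha ^+ i * b i + alpha ^+ n * y).
Proof.
elim: n b => [|n IH] b Kb Xy; first by rewrite big_ord0 add0r mul1r.
rewrite XF; exists (b ord0) => //.
exists (\sum_(i < n) (1 - alpha) * alpha ^+ i * b (lift ord0 i) + alpha ^+ n * y).
  by apply: IH.
rewrite /phi big_ord_recl expr0 mulr1 mulrDr mulrA -exprS addrC addrA.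
congr (_ + _ + _); rewrite mulr_sumr; apply: eq_bigr => i _.
by rewrite lift0 exprS; ring.
Qed.

Lemma expansion_exists n x : X x -> exists (b : nat -> R) y,
  [/\ forall i, K (b i), X y &
      x = \sum_(i < n) (1 - alpha) * alpha ^+ i * b i + alpha ^+ n * y].
Proof.
elim: n x => [|n IH] x Xx.
  (* The digits form an infinite sequence, so a point of [K] is needed even for [n = 0]; the
     invariance provides one. *)
  have [k Kk _] : hutch X x by rewrite -XF.
  by exists (fun=> k), x; split=> //; rewrite big_ord0 add0r mul1r.
have [k Kk [x' Xx' <-]] : hutch X x by rewrite -XF.
have [b [y [Kb Xy ->]]] := IH x' Xx'.
exists (fun i => if i is i'.+1 then b i' else k), y; split => //; first by case.
rewrite /phi big_ord_recl expr0 mulr1 mulrDr mulrA -exprS addrC addrA.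
congr (_ + _ + _); rewrite mulr_sumr; apply: eq_bigr => i _.
by rewrite lift0 exprS; ring.
Qed.

End Expansion.
End Attractor.

(** * Sets covered by segments of a fixed length *)

Lemma closed_segment (R : realType) (X : set R) (a b : R) : closed X ->
  a < b -> (forall y, a < y < b -> X y) -> `[a, b] `<=` X.
Proof.
move=> clX ab Xab y /=; rewrite in_itv/= => /andP[ay yb].
apply: (closed_dist clX) => e e0.
(* Moving [y] towards the midpoint by the fraction [d] gives a point strictly inside, at distance at
   most [e]. *)
pose d := Num.min (e / (b - a)) (1 / 2).
have ba : 0 < b - a by rewrite subr_gt0.
have d0 : 0 < d by rewrite lt_min divr_gt0//= divr_gt0.
have d1 : d <= 1 / 2 by rewrite ge_min lexx orbT.
have dl : d * (b - a) <= e by rewrite -ler_pdivlMr// ge_min lexx.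
exists (y + d * ((a + b) / 2 - y)); first by apply: Xab; nra.
rewrite opprD addNKr normrN normrM gtr0_norm// (le_trans _ dl)//.
by rewrite ler_pM2l// ler_norml; lra.
Qed.

(** Sort the segments by left endpoint into cells of length [l]. Two segments from one cell meet, so
    each cell fills a single segment of [X], and boundedness leaves finitely many cells. *)
Lemma finite_union_of_segments (R : realType) (X : set R) (l : R) :
  X !=set0 -> compact X -> 0 < l ->
  (forall x, X x -> exists a, a <= x <= a + l /\ `[a, a + l] `<=` X) ->
  finite_union_itv X.
Proof.
move=> [x0 Xx0] cX l0 Xl.
have clX := compact_closedR cX.
have [C XC] := compact_normr_le cX.
pose cell (j : nat) :=
  [set a | - C + j%:R * l <= a <= - C + j.+1%:R * l /\ `[a, a + l] `<=` X].
have hull j : exists cd : R * R, [/\ cd.1 < cd.2, `[cd.1, cd.2] `<=` X &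
    forall a, cell j a -> `[a, a + l] `<=` `[cd.1, cd.2]].
  have [[a0 ca0]|] := pselect (cell j !=set0); last first.
    (* An empty cell is assigned an arbitrary segment of [X], so that every index yields a
       nondegenerate interval. *)
    move=> /set0P/negP/negPn/eqP ->; have [a [_ aX]] := Xl _ Xx0.
    by exists (a, a + l); split => //=; rewrite ltrDl.
  have hlb : has_lbound (cell j).
    by exists (- C + j%:R * l) => a [/andP[]].
  have hub : has_ubound (cell j).
    by exists (- C + j.+1%:R * l) => a [/andP[]].
  have cne : cell j !=set0 by exists a0.
  have le_inf a : cell j a -> inf (cell j) <= a by move=> /(ge_inf hlb).
  have le_sup a : cell j a -> a <= sup (cell j) by move=> /(ub_le_sup hub).
  exists (inf (cell j), sup (cell j) + l); split=> /=.
  - by have := le_inf _ ca0; have := le_sup _ ca0; lra.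
  - apply: closed_segment => //.
      by have := le_inf _ ca0; have := le_sup _ ca0; lra.
    move=> y /andP[iy ys].
    have yi : 0 < y - inf (cell j) by rewrite subr_gt0.
    have [a1 ca1 ha1] := inf_adherent yi (conj cne hlb).
    have ys' : 0 < sup (cell j) + l - y by rewrite subr_gt0.
    have [a2 ca2 ha2] := sup_adherent ys' (conj cne hub).
    (* Here [a1 < y < a2 + l], and [a2 <= a1 + l] since both lie in one cell: one of the two
       segments contains [y]. *)
    have [ya1|ya1] := lerP y (a1 + l).
      by apply: ca1.2; rewrite /= in_itv/=; lra.
    apply: ca2.2; rewrite /= in_itv/=.
    case: ca1 ca2 => [/andP[h1 h2] _] [/andP[h3 h4] _].
    move: h1 h4; rewrite -[j.+1]addn1 natrD; lra.
  - move=> a ca y; rewrite /= !in_itv/=.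
    by have := le_inf _ ca; have := le_sup _ ca; lra.
have [cd hcd] := choice hull.
(* Left endpoints lie in [[- C, C]], so cell indices are at most [2 * C / l]. *)
pose n := (Num.trunc (2 * C / l)).+1.
exists n, (fun i => (cd i).1), (fun i => (cd i).2); split.
  by move=> i; have [] := hcd i.
apply/seteqP; split=> [x Xx|x [i _ xi]]; last first.
  by have [_ + _] := hcd i; apply.
have [a [ax aX]] := Xl _ Xx.
have aC : - C <= a <= C.
  have : X a by apply: aX; rewrite /= in_itv/=; lra.
  by move=> /XC; rewrite ler_norml.
have aC0 : 0 <= (a + C) / l by rewrite divr_ge0 ?(ltW l0)//; lra.
have /andP[t1 t2] := truncn_itv aC0.
rewrite ler_pdivlMr// in t1; rewrite ltr_pdivrMr// in t2.
have tn : (Num.trunc ((a + C) / l) < n)%N.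
  rewrite ltnS le_truncn// ler_pM2r ?invr_gt0//; lra.
exists (Ordinal tn) => //=; have [_ _] := hcd (Num.trunc ((a + C) / l)).
move=> /(_ a) h; apply: h; last by rewrite /= in_itv.
by split => //; lra.
Qed.

(** * From a bridge system on the digit set to segments in the attractor *)

Lemma bridge_system_attractor (R : realType) (alpha : R) (T : Type)
    (K : set R) (c : R) (lo hi : seq T -> R) :
  0 < alpha -> alpha < 1 -> bridge_system K c lo hi -> K !=set0 -> compact K ->
  exists2 KPhi : set R,
    is_attractor [set: R] K (phi alpha) KPhi & finite_union_itv KPhi.
Proof.
move=> alpha0 alpha1 KB K0 cK.
have Xattr := closure_orbit_attractor alpha0 alpha1 K0 cK.
exists (closure (orbit alpha K)) => //.
have [_ [X0 cX XF] _] := Xattr.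
set X := closure _ in X0 cX XF *.
have c0 := bridge_ratio KB; have L0 := bridge_root KB.
rewrite -subr_gt0 in L0; set L := hi [::] - lo [::] in L0.
have [N cN] : exists N, 1 <= N%:R * c - c.
  have ic0 : 0 <= c^-1 by rewrite invr_ge0 ltW.
  (* The condition reads [(N - 1) * c >= 1], hence the successor of a bound for [c^-1]. *)
  exists (Num.bound c^-1).+1; rewrite -natr1 mulrDl mul1r addrK.
  by rewrite -ler_pdivrMr// mul1r ltW// archi_boundP.
pose lam (n : 'I_N) := (1 - alpha) * alpha ^+ n.
have lam0 n : 0 < lam n by rewrite mulr_gt0 ?exprn_gt0 ?subr_gt0.
(* This is the root bridge scaled by the weight of digit [N]. That weight is below every [lam n], so
   [l / lam n <= L] and [bridge_scale] applies to each of the first [N] digits. *)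
pose l := (1 - alpha) * alpha ^+ N * L.
have l0 : 0 < l by rewrite mulr_gt0// mulr_gt0 ?exprn_gt0 ?subr_gt0.
apply: (finite_union_of_segments X0 cX l0) => x Xx.
have [b [y [Kb Xy xE]]] := expansion_exists XF N Xx.
have scale (n : 'I_N) : exists w, lo w <= b n <= hi w /\
    c * l <= lam n * (hi w - lo w) <= l.
  have rn : 0 < l / lam n <= L.
    rewrite divr_gt0//= ler_pdivrMr// [L * _]mulrC /l ler_pM2r//.
    rewrite /lam ler_pM2l ?subr_gt0// ler_wiXn2l ?(ltW alpha0) ?(ltW alpha1)//.
    exact/ltnW/ltn_ord.
  have [w bw /andP[h1 h2]] := bridge_scale KB (Kb n) rn.
  exists w; split => //; rewrite [lam n * _]mulrC -ler_pdivrMr// -mulrA h1/=.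
  by rewrite -ler_pdivlMr.
have [w hw] := choice scale.
have slo_shi : \sum_n lam n * lo (w n) + l <= \sum_n lam n * hi (w n).
  rewrite -lerBrDl -sumrB; apply: (@le_trans _ _ (\sum_(n < N) c * l)).
    rewrite sumr_const card_ord -mulr_natl mulrA; nra.
  by apply: ler_sum => n _; have [_ /andP[+ _]] := hw n; rewrite mulrBr.
have sumX t : \sum_n lam n * lo (w n) <= t <= \sum_n lam n * hi (w n) ->
    X (t + alpha ^+ N * y).
  move=> ht; apply: closed_dist; first exact: closed_closure.
  move=> e e0.
  have bal i j : c * (lam i * (hi (w i) - lo (w i))) <=
      lam j * (hi (w j) - lo (w j)).
    have [_ /andP[_ hi']] := hw i; have [_ /andP[hj _]] := hw j.
    by rewrite (le_trans _ hj)// ler_pM2l.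
  have [k Kk tk] := bridge_sum_approx KB lam0 cN bal ht e0.
  exists (\sum_(n < N) lam n * k n + alpha ^+ N * y).
    exact: (expansion_mem XF).
  by rewrite opprD addrACA subrr addr0.
have xw : \sum_n lam n * lo (w n) <= x - alpha ^+ N * y
    <= \sum_n lam n * hi (w n).
  rewrite xE addrK; apply/andP; split; apply: ler_sum => n _;
    by have [/andP[h1 h2] _] := hw n; rewrite -/(lam n) ler_pM2l.
have XI u : \sum_n lam n * lo (w n) <= u - alpha ^+ N * y
    <= \sum_n lam n * hi (w n) -> X u.
  by move=> /sumX; rewrite subrK.
move: slo_shi xw XI; set s := \sum_n _; set s' := \sum_n _; set z := _ * y.
move=> ss' xs XI.
(* The interval from [s + z] to [s' + z] lies in [X] and has length at least [l]: take its initial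
   segment if that reaches [x], and otherwise the segment ending at [x]. *)
case: (lerP x (s + z + l)) => xl.
  exists (s + z); split; first by lra.
  by move=> u; rewrite /= in_itv/= => hu; apply: XI; lra.
exists (x - l); split; first by lra.
by move=> u; rewrite /= in_itv/= => hu; apply: XI; lra.
Qed.

(** * Constructions as bridge systems *)

Lemma ulbd_bridge_system (R : realType) (a b : seq bool -> R) :
  construction a b -> ulbd a b ->
  exists c, bridge_system (constructed_set a b) c a b.
Proof.
move=> cab [c c0 hc]; exists c.
have len w j : c * (b w - a w) <= b (rcons w j) - a (rcons w j).
  have [ab _] := cab w.
  by have := hc w j; rewrite /dissection_ratio ler_pdivlMr// subr_gt0.
have nest w j : a w <= a (rcons w j) /\ b (rcons w j) <= b w.
  have [? [? ? ? ? ?]] := cab w; case: j; split; lra.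
split=> //.
- by have [] := cab [::].
(* The disjoint sibling takes at least a fraction [c], which leaves at most [1 - c]. *)
- move=> w j; rewrite len/=; have := len w (~~ j).
  by have [? [? ? ? ? ?]] := cab w; case: j => /=; lra.
- by move=> w; exists false; have [_ []] := cab w.
- by move=> w; exists true; have [_ []] := cab w.
- move=> w; exists (a w); last by rewrite lexx ltW//; have [] := cab w.
  (* Left children keep the left endpoint, so [a w] lies in the interval of every prefix of [v]; the
     padding ensures a prefix of length [n]. *)
  move=> n _; pose v := w ++ nseq n false.
  have sv : (n <= size v)%N by rewrite size_cat size_nseq leq_addl.
  exists (take n v); first by rewrite /= size_takel.
  have av : a v = a w.
    rewrite /v; elim: {v sv} n => [|n <-]; first by rewrite cats0.
    by rewrite -addn1 nseqD catA cats1; have [_ [->]] := cab (w ++ nseq n false).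
  have [h1 h2] := nested_cat nest (take n v) (drop n v).
  rewrite cat_take_drop av in h1 h2; have [h3 _] := cab v.
  by rewrite /= in_itv/= h1 (le_trans _ h2)// -av ltW.
- by move=> x n /(_ n I)[w sw xw]; exists w.
Qed.

(** * Calculus and order on a compact interval *)

Lemma derivable_in_continuous (R : realType) (I : set R) (f : R -> R) :
  derivable_in I f -> {within I, continuous f}.
Proof.
move=> df; apply/subspace_continuousP => x Ix.
have /cvgrPdist_lt := df x Ix; set l := lim _ => /(_ 1 ltr01) dq1.
apply/cvgrPdist_le => e e0.
have {}dq1 : \forall z \near x, z != x -> I z -> `|l - diff_quot f x z| < 1.
  exact: dq1.
suff : \forall z \near x, I z -> `|f x - f z| <= e by [].
have l1 : 0 < `|l| + 1 by rewrite ltr_wpDl.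
have ezx : \forall z \near x, `|x - z| < e / (`|l| + 1).
  have /cvgrPdist_lt := @cvg_id _ (nbhs x); apply.
  by rewrite divr_gt0.
near=> z => Iz.
have [->|zx] := eqVneq z x; first by rewrite subrr normr0 ltW.
have dz : `|l - diff_quot f x z| < 1.
  by move: zx Iz; near: z.
have xz : `|x - z| < e / (`|l| + 1) by near: z.
have q1 : `|diff_quot f x z| <= `|l| + 1.
  rewrite -[diff_quot f x z](subrK l) (le_trans (ler_normD _ _))//.
  by rewrite addrC lerD2l -normrN opprB ltW.
have fE : f x - f z = diff_quot f x z * (x - z).
  by rewrite /diff_quot; field; rewrite subr_eq0.
rewrite fE normrM (le_trans (ler_wpM2r _ q1))//.
by rewrite mulrC -ler_pdivlMr// ltW.
Unshelve. all: by end_near. Qed.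

(** Small increments from an interior point stay in the interval, so the relative derivative is the
    usual one there, which is all that the mean value theorem asks for. *)
Lemma derive_in_interior (R : realType) (p q : R) (f : R -> R) x :
  derivable_in `[p, q] f -> x \in `]p, q[ ->
  is_derive x 1 f (derive_in `[p, q] f x).
Proof.
move=> df; rewrite in_itv/= => /andP[px xq].
have Ix : `[p, q]%classic x by rewrite /= in_itv/= !ltW.
suff fl : h^-1 *: ((f \o shift x) (h *: 1) - f x) @[h --> 0^']
    --> derive_in `[p, q] f x.
  by apply: DeriveDef; [apply/cvg_ex; exists (derive_in `[p, q] f x)|exact/cvg_lim].
apply/cvgrPdist_lt => e e0.
have /cvgrPdist_lt /(_ e e0) := df x Ix.
rewrite /prop_near1 /within /= => /nbhs_ballP[d /= d0 hd].
have m0 : 0 < Num.min d (Num.min (x - p) (q - x)).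
  by rewrite !lt_min d0 !subr_gt0 px.
apply/nbhs_ballP; exists (Num.min d (Num.min (x - p) (q - x))) => //= h.
rewrite -ball_normE /= sub0r normrN !lt_min => /and3P[hd' hp hq] h0.
have xh : ball x d (h + x).
  by rewrite -ball_normE /= opprD addrCA subrr addr0 normrN.
have := hd _ xh; rewrite -subr_eq0 addrK => /(_ h0).
rewrite /diff_quot addrK [h *: 1]mulr1 [_ *: _]mulrC; apply.
rewrite in_itv/=; move: hp hq; rewrite !ltr_norml => /andP[? ?] /andP[? ?].
by apply/andP; split; lra.
Qed.

(** The points come in any order and may coincide; the distance bound on [z] is what the distortion
    estimate uses. *)
Lemma mean_value_in (R : realType) (p q : R) (f : R -> R) x y :
  derivable_in `[p, q] f -> x \in `[p, q] -> y \in `[p, q] ->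
  exists z, [/\ z \in `[p, q], `|z - x| <= `|y - x| &
    f y - f x = derive_in `[p, q] f z * (y - x)].
Proof.
move=> df; have cf := derivable_in_continuous df.
have mv u v : u \in `[p, q] -> v \in `[p, q] -> u < v ->
    exists2 z, z \in `[u, v] & f v - f u = derive_in `[p, q] f z * (v - u).
  rewrite !in_itv/= => /andP[pu uq] /andP[pv vq] uv.
  apply: MVT_segment; first exact: ltW.
    move=> z; rewrite in_itv/= => /andP[uz zv].
    by apply: derive_in_interior => //; rewrite in_itv/=; lra.
  apply: continuous_subspaceW cf => z; rewrite /= !in_itv/= => /andP[? ?].
  by apply/andP; split; lra.
move=> xI yI; move: (xI) (yI); rewrite !in_itv/= => xI' yI'.
have [xy|yx|<-] := ltgtP x y.
- have [z + fE] := mv _ _ xI yI xy; rewrite in_itv/= => /andP[xz zy].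
  exists z; split=> //; first by rewrite in_itv/=; lra.
  by rewrite !ger0_norm ?subr_ge0// ?(ltW xy)//; lra.
- have [z + fE] := mv _ _ yI xI yx; rewrite in_itv/= => /andP[yz zx].
  exists z; split; first by rewrite in_itv/=; lra.
    by rewrite !ler0_norm ?subr_le0// ?(ltW yx)//; lra.
  by rewrite -[LHS]opprB fE -mulrN opprB.
- by exists x; rewrite !subrr mulr0 normr0 lexx in_itv/=.
Qed.

(** Betweenness without orientation, since the maps of a system may reverse the order. *)
Definition between (R : realType) (x y z : R) : bool :=
  (x <= y <= z) || (z <= y <= x).

Lemma between_dist (R : realType) (x y z : R) : between x y z ->
  `|x - z| = `|x - y| + `|y - z|.
Proof.
move=> /orP[] /andP[h1 h2].
  have h3 := le_trans h1 h2.
  by rewrite !ler0_norm ?subr_le0//; lra.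
have h3 := le_trans h1 h2.
by rewrite !ger0_norm ?subr_ge0//; lra.
Qed.

Lemma between_hull (R : realType) (x y z : R) : between x y z ->
  Num.min x z <= y <= Num.max x z.
Proof.
by rewrite /between ge_min le_max => /orP[] /andP[-> ->]; rewrite ?orbT.
Qed.

Lemma between_inj (R : realType) (p q : R) (f : R -> R) x y z :
  {within `[p, q], continuous f} -> {in `[p, q] &, injective f} ->
  x \in `[p, q] -> y \in `[p, q] -> z \in `[p, q] ->
  between x y z -> between (f x) (f y) (f z).
Proof.
move=> cf fi xI yI zI; rewrite /between.
have [fm|fm] := itv_continuous_inj_mono cf fi.
  have {}fm u v : u \in `[p, q] -> v \in `[p, q] -> u <= v -> f u <= f v.
    by move=> uI vI; rewrite le_eqVlt => /orP[/eqP->//|uv]; rewrite ltW// fm.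
  by case/orP=> /andP[h1 h2]; apply/orP; [left|right]; rewrite !fm.
have {}fm u v : u \in `[p, q] -> v \in `[p, q] -> u <= v -> f v <= f u.
  by move=> uI vI; rewrite le_eqVlt => /orP[/eqP->//|uv]; rewrite ltW// fm.
by case/orP=> /andP[h1 h2]; apply/orP; [right|left]; rewrite !fm.
Qed.

(** The two difference quotients are derivatives at points at most [3 * s] apart, so they differ by
    at most [3 * B * s], with [B] a bound for the second derivative; [sigma] makes this a relative
    error. The product form allows [x = y] and [u = v]. *)
Lemma C2_distortion (R : realType) (p q : R) (f : R -> R) (sigma : R) :
  p <= q -> C2_in `[p, q] f -> 0 < sigma ->
  (forall x, x \in `[p, q] -> sigma <= `|derive_in `[p, q] f x|) ->
  exists2 L : R, 0 <= L & forall x y u v s,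
    x \in `[p, q] -> y \in `[p, q] -> u \in `[p, q] -> v \in `[p, q] ->
    `|x - y| <= s -> `|u - v| <= s -> `|x - u| <= s ->
    `|f x - f y| * `|u - v| <= (1 + L * s) * (`|f u - f v| * `|x - y|).
Proof.
move=> pq [df ddf cddf] sigma0 hsigma.
have [B hB] := compact_normr_le
  (continuous_compact cddf (@segment_compact _ p q)).
have {}hB z : z \in `[p, q] -> `|derive_in `[p, q] (derive_in `[p, q] f) z| <= B.
  by move=> zI; apply: hB; exists z.
have B0 : 0 <= B by rewrite (le_trans _ (hB p _))// in_itv/= lexx.
exists (3 * B / sigma); first by rewrite divr_ge0 ?mulr_ge0// ltW.
move=> x y u v s xI yI uI vI xy uv xu.
have s0 : 0 <= s by rewrite (le_trans _ xy).
rewrite [`|f x - f y|]distrC [`|f u - f v|]distrC.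
rewrite [`|x - y|]distrC [`|u - v|]distrC in xy uv *.
have [a [aI ax ->]] := mean_value_in df xI yI.
have [b [bI bu ->]] := mean_value_in df uI vI.
have [d [dI _ dE]] := mean_value_in ddf bI aI.
rewrite !normrM.
set fa := derive_in _ f a in dE *; set fb := derive_in _ f b in dE *.
have ab : `|a - b| <= 3 * s.
  move: (le_trans ax xy) (le_trans bu uv) xu.
  rewrite !ler_norml => /andP[? ?] /andP[? ?] /andP[? ?]; apply/andP; split; lra.
have fab : `|fa| <= `|fb| + B * (3 * s).
  have dab : `|fa - fb| <= B * (3 * s) by rewrite dE normrM ler_pM// hB.
  by have := ler_normD (fa - fb) fb; rewrite subrK; lra.
have : `|fa| <= (1 + 3 * B / sigma * s) * `|fb|.
  rewrite mulrDl mul1r; apply: (le_trans fab); apply: lerD => //.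
  have -> : B * (3 * s) = 3 * B / sigma * s * sigma by field; rewrite gt_eqF.
  by rewrite ler_wpM2l ?hsigma// mulr_ge0// divr_ge0 ?mulr_ge0// ltW.
move=> h; apply: le_trans (_ : (1 + 3 * B / sigma * s) * `|fb| * (`|y - x| * `|v - u|) <= _).
  by rewrite -(mulrA `|fa|) ler_wpM2r// mulr_ge0.
by rewrite le_eqVlt; apply/orP; left; apply/eqP; ring.
Qed.

(** * Hyperbolic systems: bounded distortion and bridges *)

Section HyperbolicIFS.
Variables (R : realType) (p q : R) (M : nat) (psi : 'I_M -> R -> R).
Hypothesis ifs : hyperbolic_ifs p q psi.

(** The head letter acts last, so appending a letter on the right precomposes and yields a
    subcylinder. *)
Let word w x := foldr psi x w.

Lemma ifs_lt : p < q.
Proof.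
have [i [j [x [y [+ + _ _ /eqP]]]]] := ifs_fixed ifs.
by rewrite !in_itv/= neq_lt => /andP[? ?] /andP[? ?] /orP[]; lra.
Qed.

Lemma ifs_bilipschitz : exists sigma delta : R, [/\ 0 < sigma, 0 < delta < 1 &
  forall i x y, x \in `[p, q] -> y \in `[p, q] ->
    sigma * `|x - y| <= `|psi i x - psi i y| <= delta * `|x - y|].
Proof.
have [sigma [delta [sigma0 delta1 h]]] := ifs_bounds ifs.
exists sigma, delta; split=> //.
  have [i _] := ifs_fixed ifs; have := ifs_lt => pq.
  have /(h i)/andP[h1 h2] : p \in `[p, q] by rewrite in_itv/= lexx ltW.
  by rewrite delta1 (lt_le_trans sigma0)// (le_trans h1).
move=> i x y xI yI; have [df _ _] := ifs_C2 ifs i.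
have [z [zI _ ->]] := mean_value_in df yI xI.
by rewrite normrM; have /andP[h1 h2] := h i z zI; rewrite !ler_wpM2r.
Qed.

Lemma word_maps w x : x \in `[p, q] -> word w x \in `[p, q].
Proof. by move=> xI; elim: w => //= i w; exact: ifs_maps. Qed.

(** The lower Lipschitz bound makes each map injective, hence monotone on the interval. *)
Lemma word_between w x y z :
  x \in `[p, q] -> y \in `[p, q] -> z \in `[p, q] ->
  between x y z -> between (word w x) (word w y) (word w z).
Proof.
move=> xI yI zI xyz; elim: w => //= i w.
have [sigma [delta [sigma0 _ h]]] := ifs_bilipschitz.
have [df _ _] := ifs_C2 ifs i.
apply: between_inj; try exact: word_maps.
  exact: derivable_in_continuous.
move=> u v uI vI uv; apply/eqP; rewrite -subr_eq0 -normr_le0.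
have /andP[+ _] := h i u v uI vI.
by rewrite uv subrr normr0 pmulr_rle0.
Qed.

(* Bounded distortion: composing [n] maps of the system multiplies the factors
   [1 + L delta^k (q - p)], [k < n], whose product converges. *)
Lemma word_distortion : exists2 D : R, 1 <= D & forall w x y u v,
  x \in `[p, q] -> y \in `[p, q] -> u \in `[p, q] -> v \in `[p, q] ->
  `|word w x - word w y| * `|u - v| <=
    D * (`|word w u - word w v| * `|x - y|).
Proof.
have pq := ifs_lt.
have [sigma [delta [sigma0 /andP[delta0 delta1] lip]]] := ifs_bilipschitz.
have dist i : exists L : R, 0 <= L /\ forall x y u v s,
    x \in `[p, q] -> y \in `[p, q] -> u \in `[p, q] -> v \in `[p, q] ->
    `|x - y| <= s -> `|u - v| <= s -> `|x - u| <= s ->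
    `|psi i x - psi i y| * `|u - v| <=
      (1 + L * s) * (`|psi i u - psi i v| * `|x - y|).
  have [s [d [s0 _ hs]]] := ifs_bounds ifs.
  have hsi x : x \in `[p, q] -> s <= `|derive_in `[p, q] (psi i) x|.
    by move=> /(hs i)/andP[].
  have [L L0 hL] := C2_distortion (ltW pq) (ifs_C2 ifs i) s0 hsi.
  by exists L.
have [Li hLi] := choice dist.
pose L := \sum_i Li i.
have LiL i : Li i <= L.
  by rewrite /L (bigD1 i)//= lerDl sumr_ge0// => j _; have [] := hLi j.
have L0 : 0 <= L by rewrite sumr_ge0// => j _; have [] := hLi j.
have diam w x y : x \in `[p, q] -> y \in `[p, q] ->
    `|word w x - word w y| <= delta ^+ size w * (q - p).
  move=> xI yI; elim: w => [|i w IH] /=.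
    move: xI yI; rewrite !in_itv/= mul1r => /andP[? ?] /andP[? ?].
    by rewrite ler_norml; apply/andP; split; lra.
  have /andP[_ h] := lip i _ _ (word_maps w xI) (word_maps w yI).
  by rewrite (le_trans h)// exprS -mulrA ler_pM2l.
(* The sum of [L * delta ^+ k * (q - p)] over [k < n], which bounds the logarithm of the distortion
   after [n] maps. *)
pose E n := L * (q - p) / (1 - delta) * (1 - delta ^+ n).
have d1 : 0 < 1 - delta by rewrite subr_gt0.
have c0 : 0 <= L * (q - p) / (1 - delta).
  by rewrite divr_ge0 ?mulr_ge0 ?subr_ge0 ?(ltW pq) ?(ltW delta1).
exists (expR (L * (q - p) / (1 - delta))).
  by rewrite (le_trans _ (expR_ge1Dx _))// lerDl.
move=> w x y u v xI yI uI vI.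
apply: (@le_trans _ _ (expR (E (size w)) *
    (`|word w u - word w v| * `|x - y|))); last first.
  rewrite ler_wpM2r ?mulr_ge0// ler_expR /E ler_piMr// lerBlDr lerDl.
  by rewrite exprn_ge0// ltW.
elim: w => [|i w IH] /=; first by rewrite /E expr0 subrr mulr0 expR0 mul1r mulrC.
set s := delta ^+ size w * (q - p).
have s0 : 0 <= s by rewrite mulr_ge0 ?exprn_ge0 ?subr_ge0 ?(ltW pq) ?(ltW delta0).
have [_ hd] := hLi i.
have {}hd := hd _ _ _ _ s (word_maps w xI) (word_maps w yI)
  (word_maps w uI) (word_maps w vI) (diam w _ _ xI yI) (diam w _ _ uI vI)
  (diam w _ _ xI uI).
have ES : expR (E (size w).+1) = expR (L * s) * expR (E (size w)).
  rewrite -expRD; congr expR; rewrite /E /s exprS; field.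
  by rewrite gt_eqF.
have Ls : 1 + Li i * s <= expR (L * s).
  by rewrite (le_trans _ (expR_ge1Dx _))// lerD2l ler_wpM2r.
move: hd IH; rewrite ES.
set X := word w x; set Y := word w y; set U := word w u; set V := word w v.
set e1 := expR (L * s) in Ls *; set e2 := expR (E _).
set A := `|psi i X - _|; set B := `|psi i U - _|.
have e10 : 0 <= e1 by exact: expR_ge0.
have B0 : 0 <= B by exact: normr_ge0.
have e20 : 0 <= e2 by exact: expR_ge0.
move=> hd IH.
have {}hd : A * `|U - V| <= e1 * (B * `|X - Y|).
  by rewrite (le_trans hd)// ler_wpM2r// mulr_ge0.
(* The two estimates are chained by cancelling [|U - V|]. If it vanishes, the induction hypothesis
   forces [X = Y] or [u = v], and the left side is zero. *)
have [UV|UV] := eqVneq `|U - V| 0.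
  move: IH; rewrite UV mul0r mulr0 => IH.
  suff -> : A * `|u - v| = 0 by rewrite !mulr_ge0.
  have /eqP : `|X - Y| * `|u - v| = 0.
    by apply/eqP; rewrite eq_le IH mulr_ge0.
  rewrite mulf_eq0 => /orP[/eqP/normr0_eq0 /subr0_eq XY|/eqP ->].
    by rewrite /A XY subrr normr0 mul0r.
  by rewrite mulr0.
have UV0 : 0 < `|U - V| by rewrite lt_neqAle eq_sym UV normr_ge0.
rewrite -(ler_pM2r UV0).
have h1 := ler_wpM2r (normr_ge0 (u - v)) hd.
have h2 : e1 * B * (`|X - Y| * `|u - v|) <=
    e1 * B * (e2 * (`|U - V| * `|x - y|)).
  by rewrite ler_wpM2l// mulr_ge0.
by move: h1 h2; lra.
Qed.

Lemma ifs_bridge_system (K : set R) : K `<=` `[p, q] ->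
  compact_invariant [set: 'I_M] psi K ->
  exists c (lo hi : seq 'I_M -> R), bridge_system K c lo hi.
Proof.
move=> KI [K0 cK KE].
have [sigma [delta [sigma0 /andP[delta0 delta1] lip]]] := ifs_bilipschitz.
have [D D1 dist] := word_distortion.
have D0 : 0 < D by exact: lt_le_trans D1.
have K_psi i x : K x -> K (psi i x).
  by move=> Kx; rewrite KE; exists i => //; exists x.
have K_img x : K x -> (\bigcup_(i in [set: 'I_M]) (psi i @` K)) x.
  by rewrite -KE.
have K_word w x : K x -> K (word w x).
  by move=> Kx; elim: w => //= i w; exact: K_psi.
have id_cont : {within K, continuous (id : R -> R)}.
  by apply: continuous_subspaceT => x; exact: cvg_id.
have [m /set_mem Km mmin] := compact_EVT_min K0 cK id_cont.
have [n /set_mem Kn nmax] := compact_EVT_max K0 cK id_cont.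
have Kmn x : K x -> m <= x <= n.
  by move=> /mem_set Kx; rewrite mmin//= nmax.
(* Otherwise [K] is one point, fixed by every map; contraction then leaves no second fixed point. *)
have mn : m < n.
  rewrite lt_neqAle; have /andP[_ ->] := Kmn _ Km; rewrite andbT.
  apply/eqP => mn.
  have fixm i x : x \in `[p, q] -> psi i x = x -> x = m.
    move=> xI fx; apply/eqP; rewrite -subr_eq0 -normr_le0.
    have pm : psi i m = m.
      by apply/le_anti; rewrite {2}mn andbC; apply/Kmn/K_psi.
    have /andP[_] := lip i x m xI (KI _ Km); rewrite fx pm.
    by rewrite -subr_le0 -{1}[`|x - m|]mul1r -mulrBl pmulr_rle0 ?subr_gt0.
  have [i [j [x [y [xI yI fx fy]]]]] := ifs_fixed ifs.
  by apply; rewrite (fixm i x)// (fixm j y).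
have Kbtw x : K x -> between m x n by move=> /Kmn mxn; rewrite /between mxn.
have w_btw w x : K x -> between (word w m) (word w x) (word w n).
  by move=> Kx; apply: word_between; [exact: KI..|exact: Kbtw].
have wrcons w j x : word (rcons w j) x = word w (psi j x).
  by rewrite /word foldr_rcons.
(* By monotonicity the images of [m] and [n] span the image of [K]; [Num.min] and [Num.max] absorb a
   reversal of order. *)
pose lo w := Num.min (word w m) (word w n).
pose hi w := Num.max (word w m) (word w n).
have lenE w : hi w - lo w = `|word w m - word w n|.
  rewrite /hi /lo; have [h|h] := leP (word w m) (word w n).
    by rewrite ler0_norm ?opprB// subr_le0.
  by rewrite gtr0_norm// subr_gt0.
have wK w x : K x -> lo w <= word w x <= hi w.
  by move=> Kx; apply: between_hull; exact: w_btw.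
(* Before applying [word w], a child has relative length at least [sigma] and leaves at least
   [1 - delta] uncovered; distortion costs a factor [D] in each. *)
pose c := Num.min (sigma / D) ((1 - delta) / D).
have cs : D * c <= sigma by rewrite mulrC -ler_pdivlMr// ge_min lexx.
have cd : D * c <= 1 - delta.
  by rewrite mulrC -ler_pdivlMr// ge_min lexx orbT.
have nest w j : lo w <= lo (rcons w j) /\ hi (rcons w j) <= hi w.
  have /andP[h1 h2] := wK w _ (K_psi j _ Km).
  have /andP[h3 h4] := wK w _ (K_psi j _ Kn).
  by rewrite /lo /hi !wrcons le_min ge_max h1 h2 h3 h4.
exists c, lo, hi; split=> //.
- by rewrite lt_min !divr_gt0// subr_gt0.
- by rewrite /lo /hi /= min_l ?max_r// ltW.
- move=> w j; rewrite !lenE !wrcons.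
  have Ks := K_psi j _ Km; have Kt := K_psi j _ Kn.
  have /andP[l1 l2] := lip j m n (KI _ Km) (KI _ Kn).
  have mn0 : 0 < `|m - n| by rewrite normr_gt0 subr_eq0 lt_eqF.
  set W := `|word w m - word w n|.
  have W0 : 0 <= W by exact: normr_ge0.
  have ratio u v : K u -> K v ->
      W * `|u - v| <= D * (`|word w u - word w v| * `|m - n|).
    by move=> Ku Kv; apply: dist; exact: KI.
  (* The upper bound on a child comes from a lower bound on the two pieces of the bridge outside it,
     from [m] to [u] and from [v] to [n]. *)
  have outer u v : K u -> K v -> u <= v -> `|u - v| <= delta * `|m - n| ->
      `|word w u - word w v| <= (1 - c) * W.
    move=> Ku Kv uv uvd.
    have /andP[mu un] := Kmn _ Ku; have /andP[mv vn] := Kmn _ Kv.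
    have btw x y z : K x -> K y -> K z -> x <= y -> y <= z ->
        `|word w x - word w z| =
        `|word w x - word w y| + `|word w y - word w z|.
      move=> Kx Ky Kz xy yz; apply: between_dist.
      apply: word_between; [exact: KI..|].
      by rewrite /between xy yz.
    have WE := btw _ _ _ Km Ku Kn mu un.
    rewrite (btw _ _ _ Ku Kv Kn uv vn) -/W in WE.
    have h1 := ratio _ _ Km Ku; have h2 := ratio _ _ Kv Kn.
    have h3 : (1 - delta) * `|m - n| <= `|m - u| + `|v - n|.
      move: uvd; rewrite !ler0_norm ?subr_le0 ?(ltW mn)//; lra.
    have : W * ((1 - delta) * `|m - n|) <=
        D * (W - `|word w u - word w v|) * `|m - n|.
      apply: le_trans (ler_wpM2l W0 h3) _; rewrite WE in h1 h2 *; lra.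
    rewrite mulrA ler_pM2r// => h4.
    have h5 := ler_wpM2l W0 cd.
    have : D * (c * W) <= D * (W - `|word w u - word w v|) by lra.
    by rewrite ler_pM2l//; lra.
  apply/andP; split.
    rewrite -(ler_pM2l D0) -(ler_pM2r mn0).
    apply: le_trans (_ : W * (sigma * `|m - n|) <= _).
      have := ler_wpM2l W0 (ler_wpM2r (ltW mn0) cs); lra.
    apply: le_trans (ler_wpM2l W0 l1) _.
    by have := ratio _ _ Ks Kt; lra.
  have [st|/ltW ts] := leP (psi j m) (psi j n); first exact: outer.
  by rewrite distrC; apply: outer => //; rewrite distrC.
- move=> w.
  have [u Ku uE] : exists2 u, K u & lo w = word w u.
    by rewrite /lo; case: leP => _; [exists m|exists n].
  have [j _ [v Kv vu]] := K_img _ Ku; exists j.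
  apply/le_anti; have [-> _] := nest w j; rewrite andbT uE -vu -wrcons.
  by have /andP[] := wK (rcons w j) v Kv.
- move=> w.
  have [u Ku uE] : exists2 u, K u & hi w = word w u.
    by rewrite /hi; case: leP => _; [exists n|exists m].
  have [j _ [v Kv vu]] := K_img _ Ku; exists j.
  apply/le_anti; have [_ ->] := nest w j; rewrite uE -vu -wrcons.
  by have /andP[] := wK (rcons w j) v Kv.
- by move=> w; exists (word w m); [exact: K_word|exact: wK].
- move=> x k Kx.
  suff [w [sw [y [Ky ->]]]] : exists w, size w = k /\
      exists y, K y /\ x = word w y by exists w => //; exact: wK.
  elim: k x Kx => [|k IH] x Kx; first by exists [::]; split=> //; exists x.
  have [j _ [x' Kx' <-]] := K_img _ Kx.
  have [w [sw [y [Ky ->]]]] := IH x' Kx'.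
  by exists (j :: w); split; [rewrite /= sw|exists y].
Qed.
End HyperbolicIFS.

Theorem theorem1p1 (R : realType) (alpha : R) (alpha0 : 0 < alpha)
    (alpha1 : alpha < 1) :
  (forall (p q : R) (M : nat) (psi : 'I_M -> R -> R) (KPsi : set R),
     hyperbolic_ifs p q psi ->
     is_attractor `[p, q] [set: 'I_M] psi KPsi ->
     exists2 KPhi : set R,
       is_attractor [set: R] KPsi (phi alpha) KPhi & finite_union_itv KPhi)
  /\
  (forall K : set R,
     cantor_set K -> admits_ulbd K ->
     exists2 KPhi : set R,
       is_attractor [set: R] K (phi alpha) KPhi & finite_union_itv KPhi).
Proof.
split=> [p q M psi K ifs [KI Kinv _]|K [K0 cK _ _] [a [b [cab uab KE]]]].
  have [c [lo [hi KB]]] := ifs_bridge_system ifs KI Kinv.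
  have [K0 cK _] := Kinv.
  exact: bridge_system_attractor alpha0 alpha1 KB K0 cK.
have [c KB] := ulbd_bridge_system cab uab.
rewrite -KE in KB.
exact: bridge_system_attractor alpha0 alpha1 KB K0 cK.
Qed.
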